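(* Let $G$ be a (possibly infinite-dimensional) Lie group with Lie algebra $\mathfrak g$, and let $A:\mathfrak g\to\mathfrak g^*$ be a degenerate inertia operator whose kernel is a Lie subalgebra $\mathfrak k\subset\mathfrak g$. Let $K\subset G$ be the subgroup corresponding to $\mathfrak k$, and let $E(v)=\frac12\langle v,Av\rangle$ be the corresponding energy quadratic form on $\mathfrak g$. Let $E_G$ be the right-invariant degenerate form (metric) on $G$ obtained by right-translating $E$ from the identity to every point of $G$. Then $E_G$ descends to a form on the space $G/K$ of right cosets $\{Kg: g\in G\}$ if and only if the quadratic form $E$ on $\mathfrak g$ vanishes on the Lie subalgebra $\mathfrak k$ and is $\mathrm{Ad}$-invariant with respect to the action of this subalgebra, the condition of $\mathrm{Ad}$-invariance being $$\langle \mathrm{ad}_w v,Au\rangle=-\langle v,A(\mathrm{ad}_w u)\rangle\qquad\text{for all }w\in\mathfrak k\text{ and any }u,v\in\mathfrak g.$$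
   Context: $G/K$ denotes the space of right cosets $Kg$, on which $G$ acts on the right. The inertia operator $A$ is the (symmetric) linear operator $\mathfrak g\to\mathfrak g^*$ associated with the energy quadratic form $E$; $\langle\cdot,\cdot\rangle$ is the natural pairing between $\mathfrak g$ and $\mathfrak g^*$, and $\mathrm{ad}_w v=[w,v]$ is the adjoint action in $\mathfrak g$. ''$E_G$ descends to $G/K$'' means that $E_G$ is the pullback, under the projection $G\to G/K$, $g\mapsto Kg$, of a form on $G/K$. The displayed invariance condition is described in the paper as an infinitesimal version of the invariance of $E$ with respect to the subgroup action, $\langle \mathrm{Ad}_k v,A(\mathrm{Ad}_k u)\rangle=\langle v,Au\rangle$ for all $k\in K$. *)

(* Defs.v *)
From HB Require Import structures.
From mathcomp Require Import all_boot all_order all_algebra.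
From mathcomp Require Import all_classical all_reals topology tvs.

Set Implicit Arguments.
Unset Strict Implicit.
Unset Printing Implicit Defensive.

Import GRing.Theory Num.Theory.
Import numFieldTopology.Exports.
Local Open Scope classical_set_scope.
Local Open Scope ring_scope.

(* Smooth maps between locally convex spaces, in the sense of Michal-Bastiani:
   f is C^(k+1) on the open set U iff f is continuous, has all its directional
   derivatives on U, and df : U x E -> F is C^k. Between Banach spaces, and in
   particular in finite dimension, the C^oo maps are the usual ones. *)

(* The difference quotient is that of [derivable] and [derive] in
   mathcomp-analysis, which are restricted to normed modules. *)
Definition is_dir_derive (R : realType) (E F : tvsType R) (f : E -> F)
    (a v : E) (l : F) : Prop :=
  (fun h : R => h^-1 *: (f (h *: v + a) - f a)) @ (0 : R)^' --> l.

Definition dir_derivable (R : realType) (E F : tvsType R) (f : E -> F)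
    (a v : E) : Prop :=
  exists l, is_dir_derive f a v l.

Definition dir_derive (R : realType) (E F : tvsType R) (f : E -> F)
    (a v : E) : F :=
  xget 0 [set l | is_dir_derive f a v l].

Fixpoint Ck_on (R : realType) (k : nat) (E F : tvsType R) (U : set E)
    (f : E -> F) : Prop :=
  (forall x, U x -> {for x, continuous f}) /\
  match k with
  | 0 => True
  | k'.+1 => (forall x v, U x -> dir_derivable f x v) /\
             Ck_on k' (U `*` setT) (fun p : E * E => dir_derive f p.1 p.2)
  end.

Definition smooth_on (R : realType) (E F : tvsType R) (U : set E)
    (f : E -> F) : Prop :=
  open U /\ forall k, Ck_on k U f.

(* The set M, with one distinguished chart (dom x, chart x) around each point x;
   the topology of M is the one induced by the charts. No generality is lost by
   indexing an atlas by points, and T_x M is then identified with the model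
   space E by means of chart x. *)
Record manifold (R : realType) (E : tvsType R) (M : Type) := Manifold {
  dom : M -> set M;
  chart : M -> M -> E;
  chart_inv : M -> E -> M;
  mem_dom : forall x, dom x x;
  chartK : forall x y, dom x y -> chart_inv x (chart x y) = y;
  smooth_transition : forall x y,
    smooth_on (chart x @` (dom x `&` dom y)) (chart y \o chart_inv x);
  model_hausdorff : hausdorff_space E;
  manifold_hausdorff : forall a b : M, a <> b -> exists U V : set M,
    [/\ forall x, open (chart x @` (dom x `&` U)),
        forall x, open (chart x @` (dom x `&` V)),
        U a, V b & U `&` V = set0]
}.

Definition mopen (R : realType) (E : tvsType R) (M : Type)
    (mM : manifold E M) (W : set M) : Prop :=
  forall x, open (chart mM x @` (dom mM x `&` W)).

Definition mconnected (R : realType) (E : tvsType R) (M : Type)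
    (mM : manifold E M) : Prop :=
  forall W : set M,
    mopen mM W -> mopen mM (~` W) -> W !=set0 -> W = setT.

(* The openness contained in [smooth_on] entails that W is open and that f is
   continuous on W. *)
Definition smooth_map_on (R : realType) (E F : tvsType R) (M N : Type)
    (mM : manifold E M) (mN : manifold F N) (W : set M) (f : M -> N) : Prop :=
  forall x y,
    smooth_on (chart mM x @` (dom mM x `&` W `&` f @^-1` dom mN y))
              (chart mN y \o f \o chart_inv mM x).

Definition smooth_map (R : realType) (E F : tvsType R) (M N : Type)
    (mM : manifold E M) (mN : manifold F N) (f : M -> N) : Prop :=
  smooth_map_on mM mN setT f.

(* T_x f : T_x M -> T_(f x) N *)
Definition tangent_map (R : realType) (E F : tvsType R) (M N : Type)
    (mM : manifold E M) (mN : manifold F N) (f : M -> N) (x : M) (v : E) : F :=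
  dir_derive (chart mN (f x) \o f \o chart_inv mM x) (chart mM x x) v.

Definition quadratic_form (R : realType) (V : lmodType R) (q : V -> R) : Prop :=
  exists b : V -> V -> R,
    [/\ forall a u v w, b (a *: u + v) w = a * b u w + b v w,
        forall u v, b u v = b v u
      & forall v, q v = b v v].

(* A field Q of quadratic forms on the tangent spaces. The vector of T_y M with
   coordinates v in chart x is sent to its coordinates in chart y before
   applying Q y. *)
Definition smooth_form (R : realType) (E : tvsType R) (M : Type)
    (mM : manifold E M) (Q : M -> E -> R) : Prop :=
  (forall x, quadratic_form (Q x)) /\
  (forall x, smooth_on ((chart mM x @` dom mM x) `*` setT)
     (fun p : E * E =>
        let y := chart_inv mM x p.1 in
        Q y (dir_derive (chart mM y \o chart_inv mM x) p.1 p.2) : R^o)).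

(* The first condition is smoothness of the multiplication with respect to the
   product charts of G x G. *)
Definition lie_group (R : realType) (E : tvsType R) (G : groupType)
    (mG : manifold E G) : Prop :=
  (forall x y z,
     smooth_on
       ((fun p : G * G => (chart mG x p.1, chart mG y p.2)) @`
          [set p : G * G | [/\ dom mG x p.1, dom mG y p.2
                             & dom mG z (p.1 * p.2)%g]])
       (fun u : E * E =>
          chart mG z (chart_inv mG x u.1 * chart_inv mG y u.2)%g)) /\
  smooth_map mG mG (fun g : G => g^-1%g).

(* The Lie algebra of G is T_1 G = E, with bracket [w, v] = ad_w v, where ad is
   the derivative at 1 of the adjoint representation Ad. *)
Definition Ad (R : realType) (E : tvsType R) (G : groupType)
    (mG : manifold E G) (g : G) (v : E) : E :=
  tangent_map mG mG (fun h : G => g * h * g^-1)%g 1%g v.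

Definition ad (R : realType) (E : tvsType R) (G : groupType)
    (mG : manifold E G) (w v : E) : E :=
  dir_derive (fun x => Ad mG (chart_inv mG 1%g x) v) (chart mG 1%g 1%g) w.

Definition lie_subalgebra (R : realType) (E : tvsType R) (G : groupType)
    (mG : manifold E G) (k : set E) : Prop :=
  [/\ k 0, forall a u v, k u -> k v -> k (a *: u + v)
    & forall u v, k u -> k v -> k (ad mG u v)].

Record dual (R : realType) (E : tvsType R) := Dual {
  dual_fun :> {linear E -> R^o};
  dual_continuous : continuous dual_fun
}.

Definition pairing (R : realType) (E : tvsType R) (v : E) (l : dual E) : R :=
  l v.

Definition energy (R : realType) (E : tvsType R) (A : E -> dual E) (v : E) : R :=
  2^-1 * pairing v (A v).

(* Continuity of the energy (automatic on Frechet spaces) is what makes its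
   right translate a smooth form on G. *)
Definition inertia_operator (R : realType) (E : tvsType R) (A : E -> dual E) :
    Prop :=
  [/\ forall a u v w,
        pairing w (A (a *: u + v)) = a * pairing w (A u) + pairing w (A v),
      forall u v, pairing v (A u) = pairing u (A v)
    & continuous (energy A : E -> R^o)].

Definition op_ker (R : realType) (E : tvsType R) (A : E -> dual E) : set E :=
  [set v | forall u, pairing u (A v) = 0].

Definition degenerate (R : realType) (E : tvsType R) (A : E -> dual E) : Prop :=
  exists2 v, v != 0 & op_ker A v.

(* K is the connected Lie subgroup of G with Lie algebra k: it is the image of a
   connected Lie group H under an injective smooth homomorphism iota whose
   tangent map at 1 is a bijection from the Lie algebra of H onto k. *)
Record lie_subgroup_of_subalgebra (R : realType) (E F : tvsType R)
    (G H : groupType) (mG : manifold E G) (mH : manifold F H) (iota : H -> G)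
    (k : set E) (K : set G) : Prop := {
  sub_lie_group : lie_group mH;
  sub_connected : mconnected mH;
  sub_morph : {morph iota : x y / (x * y)%g};
  sub_inj : injective iota;
  sub_smooth : smooth_map mH mG iota;
  sub_range : range iota = K;
  sub_tangent : set_bij setT k (tangent_map mH mG iota 1%g)
}.

Definition right_coset (G : groupType) (K : set G) (g : G) : set G :=
  [set (k * g)%g | k in K].

Definition coset_space (G : groupType) (K : set G) : Type :=
  {C : set G | exists g, C = right_coset K g}.

Definition coset_proj (G : groupType) (K : set G) (g : G) : coset_space K :=
  exist _ (right_coset K g) (ex_intro _ g erefl).

(* A manifold structure on the space of right cosets of K = iota(H) which makes
   it the quotient manifold: the projection is a submersion (it is smooth and
   has smooth local sections through every point of G), and its vertical
   space at g is the tangent space of the coset K g = {iota(h) g}. *)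
Record quotient_manifold (R : realType) (E F E' : tvsType R)
    (G H : groupType) (mG : manifold E G) (mH : manifold F H) (iota : H -> G)
    (K : set G) (mQ : manifold E' (coset_space K)) : Prop := {
  proj_smooth : smooth_map mG mQ (@coset_proj G K);
  proj_section : forall g : G,
    exists (W : set (coset_space K)) (s : coset_space K -> G),
      [/\ W (coset_proj K g), s (coset_proj K g) = g,
          smooth_map_on mQ mG W s
        & forall q, W q -> coset_proj K (s q) = q];
  proj_vertical : forall (g : G),
    [set X | tangent_map mG mQ (@coset_proj G K) g X = 0] =
    range (tangent_map mH mG (fun h : H => iota h * g)%g 1%g)
}.

(* The right-invariant form equal to q at 1: E_G(g)(X) = q(T_g R_(g^-1) X). *)
Definition right_invariant_form (R : realType) (E : tvsType R) (G : groupType)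
    (mG : manifold E G) (q : E -> R) (g : G) (X : E) : R :=
  q (tangent_map mG mG (fun p : G => p * g^-1)%g g X).

Definition descends (R : realType) (E E' : tvsType R) (G : groupType)
    (mG : manifold E G) (K : set G) (mQ : manifold E' (coset_space K))
    (B : G -> E -> R) : Prop :=
  exists2 Q : coset_space K -> E' -> R, smooth_form mQ Q
    & forall g X,
        B g X = Q (coset_proj K g) (tangent_map mG mQ (@coset_proj G K) g X).

(* Main.v *)
Require Import Defs.
From HB Require Import structures.
From mathcomp Require Import all_boot all_order all_algebra.
From mathcomp Require Import all_classical all_reals topology tvs.
From mathcomp Require Import convex interval_inference ring lra.

Set Implicit Arguments.
Unset Strict Implicit.
Unset Printing Implicit Defensive.

Import Order.TTheory GRing.Theory Num.Theory.
Import numFieldTopology.Exports.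
Local Open Scope classical_set_scope.
Local Open Scope ring_scope.

(** Right translations identify every tangent space of G with the Lie algebra;
    read through this identification, the left translation by k is Ad_k. The
    projection to the cosets K g is unchanged by left translations by K, so a
    form E_G that descends is preserved by them, which says that E is invariant
    under Ad_k for all k in K (descends_Ad_invariant). Conversely, two tangent
    vectors of G with the same image in the quotient differ, after a left
    translation by some k in K, by a vertical vector, and vertical vectors are
    the right translates of the kernel of A. Adding a vector of the kernel does
    not change the energy, so Ad_K-invariance makes E_G constant on the fibres
    of the tangent map of the projection (right_invariant_form_fiber), and
    local sections carry its smoothness to the quotient
    (Ad_invariant_descends).

    It remains to compare invariance under K with invariance under its Lie
    algebra. Along a curve iota (c t) in K with c 0 = 1 and velocity w, the
    derivative of E (Ad_(iota (c t)) v) at 0 is the pairing of v with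
    A (ad_w v) (energy_Ad_derive). Invariance makes it vanish, and every w in
    the kernel is such a velocity (Ad_invariant_ad). If it vanishes for all w
    and v, then h |-> E (Ad_(iota h) v) has zero derivative everywhere, because
    Ad is multiplicative, and is constant because H is connected
    (ad_Ad_invariant). The vanishing of the pairing of v with A (ad_w v) is the
    restriction to the diagonal of the skew-symmetry of ad_w, and polarization
    recovers the latter (ad_skew_diag). The energy vanishes on the kernel of A
    by its very definition.

    The analysis takes place in locally convex spaces, where neither a norm nor
    an inverse function theorem is at hand. It rests on a mean value inequality
    in open convex sets (mean_value_convex), from which difference quotients of
    C^1 maps converge even when the base point and the direction move
    (strict_slope). This gives the chain rule, the linearity of derivatives in
    the direction, and the stability of C^k maps under composition. Manifolds
    are handled through smooth maps from open subsets of model spaces (plots)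
    and their velocities, so that a tangent map is computed by pushing
    plots. *)

(** * Slopes in convex sets *)

Definition convex_subset (R : realType) (V : lmodType R) (C : set V) : Prop :=
  forall (t : R) x y, 0 <= t <= 1 -> C x -> C y -> C (t *: x + (1 - t) *: y).

Lemma nbhs_convex_open (R : realType) (F : tvsType R) (l : F) (D : set F) :
  nbhs l D -> exists C : set F, [/\ open C, C l, convex_subset C & C `<=` D].
Proof.
have [B Bconv [Bopen Bnbhs]] := @locally_convex R F.
move=> /Bnbhs [C [BC Cl] CD]; exists C; split => //; first exact: Bopen.
move=> t x y /andP[t0 t1] Cx Cy.
have := Bconv C (mem_set BC) x y (Itv01 t0 t1) (mem_set Cx) (mem_set Cy).
by rewrite inE.
Qed.

(** The slope over [r, t] is a convex combination of the slopes over [r, s] and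
    [s, t]. *)
Lemma convex_subset_slope (R : realType) (F : lmodType R) (C : set F)
    (phi : R -> F) (r s t : R) : convex_subset C -> r < s -> s < t ->
  C ((s - r)^-1 *: (phi s - phi r)) -> C ((t - s)^-1 *: (phi t - phi s)) ->
  C ((t - r)^-1 *: (phi t - phi r)).
Proof.
move=> cC rs st C1 C2.
have sr0 : 0 < s - r by rewrite subr_gt0.
have ts0 : 0 < t - s by rewrite subr_gt0.
have tr0 : 0 < t - r by rewrite subr_gt0 (lt_trans rs).
have := cC ((s - r) / (t - r)) _ _ _ C1 C2.
have -> : 1 - (s - r) / (t - r) = (t - s) / (t - r).
  by field; rewrite gt_eqF.
rewrite !scalerA mulrAC divff ?gt_eqF// mul1r mulrAC divff ?gt_eqF// mul1r.
rewrite -scalerDr [X in _ *: X]addrC subrKA; apply.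
apply/andP; split; first by apply: divr_ge0; apply: ltW.
by rewrite ler_pdivrMr // mul1r lerD2r ltW.
Qed.

(** The mean value inequality in the form suited to locally convex spaces, whose
    neighbourhoods are generated by convex sets. Slopes over adjacent intervals
    average, so a supremum argument propagates membership in C from 0 to 1. *)
Lemma mean_value_convex (R : realType) (F : lmodType R) (C : set F)
    (phi : R -> F) : convex_subset C ->
  (forall s, 0 <= s <= 1 ->
     \forall h \near (0 : R)^', C (h^-1 *: (phi (s + h) - phi s))) ->
  C (phi 1 - phi 0).
Proof.
move=> cC dphi.
have gauge s : 0 <= s <= 1 -> exists2 d : R, 0 < d & forall h,
    `|h| < d -> h != 0 -> C (h^-1 *: (phi (s + h) - phi s)).
  move=> /dphi /nbhs_ballP[d /= d0 hd]; exists d => // h hh h0.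
  by apply: hd => //=; rewrite /ball /= sub0r normrN.
(* The case t = 0 is separate because the slope over [0, 0] is 0, which may
   lie outside C. *)
pose S := [set t : R | 0 <= t <= 1 /\
             (t = 0 \/ C ((t - 0)^-1 *: (phi t - phi 0)))].
have S0 : S 0 by split; [rewrite lexx ler01 | left].
have ubS : ubound S 1 by move=> t [/andP[]].
have supS : has_sup S by split; [exists 0 | exists 1].
pose s := sup S.
have s0 : 0 <= s by apply: sup_upper_bound.
have s1 : s <= 1 by apply: ge_sup; [exists 0 | exact: ubS].
have [d d0 hd] : exists2 d : R, 0 < d & forall h,
    `|h| < d -> h != 0 -> C (h^-1 *: (phi (s + h) - phi s)).
  by apply: gauge; rewrite s0.
have slopeL a : s - d < a -> a < s -> C ((s - a)^-1 *: (phi s - phi a)).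
  move=> da als.
  have -> : (s - a)^-1 *: (phi s - phi a) =
            (a - s)^-1 *: (phi (s + (a - s)) - phi s).
    rewrite [s + (a - s)]addrC subrK -[a - s]opprB.
    by rewrite invrN scaleNr -scalerN opprB.
  apply: hd; last by rewrite subr_eq0 lt_eqF.
  by rewrite -normrN opprB gtr0_norm ?subr_gt0//; lra.
have slopeR b : s < b -> b < s + d -> C ((b - s)^-1 *: (phi b - phi s)).
  move=> sb bd; have := hd (b - s).
  rewrite gtr0_norm ?subr_gt0// [s + (b - s)]addrC subrK.
  by apply; [lra | rewrite gt_eqF // subr_gt0].
(* The supremum is attained: a point of S just below s has a slope from 0 and
   a slope to s in C. *)
have Ss : S s.
  have [a [a01 Sa] da] := sup_adherent d0 supS.
  have as_ : a <= s by apply: sup_upper_bound.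
  split; first by rewrite s0.
  move: as_; rewrite le_eqVlt => /orP[/eqP <- // | als]; right.
  have Ca := slopeL _ da als.
  have [a0|a_neq0] := eqVneq a 0; first by rewrite a0 in Ca.
  case: Sa a_neq0 => [->|Sa a_neq0]; first by rewrite eqxx.
  apply: (convex_subset_slope cC _ als Sa Ca).
  by rewrite lt_neqAle eq_sym a_neq0; case/andP: a01.
have es1 : s = 1.
  apply/eqP; rewrite eq_le s1 /= leNgt; apply/negP => sl1.
  pose b := Num.min 1 (s + d / 2).
  have sb : s < b by rewrite /b lt_min sl1 ltrDl divr_gt0.
  have bd : b < s + d by rewrite /b gt_min; apply/orP; right; lra.
  have b1 : b <= 1 by rewrite /b ge_min lexx.
  have Cb := slopeR _ sb bd.
  suff /(sup_upper_bound supS) : S b by rewrite leNgt sb.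
  split; first by rewrite b1 (le_trans s0 (ltW sb)).
  right; case: Ss => _ [s_0|Cs]; first by rewrite -s_0.
  move: s0; rewrite le_eqVlt => /orP[/eqP -> // | s0].
  exact: (convex_subset_slope cC s0 sb Cs Cb).
case: Ss => _; rewrite es1 => -[/eqP|]; first by rewrite oner_eq0.
by rewrite subr0 invr1 scale1r.
Qed.

(** * Directional derivatives in locally convex spaces *)

Lemma prod_hausdorff (S T : topologicalType) :
  hausdorff_space S -> hausdorff_space T -> hausdorff_space (S * T)%type.
Proof.
move=> hS hT [a b] [c d] cl; congr (_, _).
  apply: hS => A B Aa Bc.
  have [] := cl (A `*` setT) (B `*` setT).
  - by exists (A, setT) => //; split => //; exact: filterT.
  - by exists (B, setT) => //; split => //; exact: filterT.
  by move=> [x y] [[/= Ax _] [/= Bx _]]; exists x.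
apply: hT => A B Ab Bd.
have [] := cl (setT `*` A) (setT `*` B).
- by exists (setT, A) => //; split => //; exact: filterT.
- by exists (setT, B) => //; split => //; exact: filterT.
by move=> [x y] [[/= _ Ay] [/= _ By]]; exists y.
Qed.

Lemma setXT_open (S T : topologicalType) (U : set S) :
  open U -> open (U `*` [set: T]).
Proof.
rewrite !openE => oU [x y] [/= Ux _].
by exists (U, setT) => //; split; [exact: oU | exact: filterT].
Qed.

Lemma dir_derive_unique (R : realType) (E F : tvsType R) (f : E -> F) a v l :
  hausdorff_space F -> is_dir_derive f a v l -> dir_derive f a v = l.
Proof.
move=> hF fl; apply: (cvg_unique hF _ fl).
exact: (@xgetPex _ 0 [set l | is_dir_derive f a v l] (ex_intro _ l fl)).
Qed.

Lemma dir_deriveP (R : realType) (E F : tvsType R) (f : E -> F) a v :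
  dir_derivable f a v -> is_dir_derive f a v (dir_derive f a v).
Proof. exact: xgetPex. Qed.

Lemma tvs_cvgD (R : realType) (E : tvsType R) (T : Type) (F : set_system T)
    {FF : Filter F} (f g : T -> E) (a b : E) :
  f @ F --> a -> g @ F --> b -> (fun x => f x + g x) @ F --> a + b.
Proof.
move=> fa gb.
apply: (@cvg_comp2 _ _ _ _ _ _ _ (nbhs (a + b)) _ _ _ _ _ +%R fa gb).
exact: (@add_continuous E (_, _)).
Qed.

Lemma tvs_cvgZ (R : realType) (E : tvsType R) (T : Type) (F : set_system T)
    {FF : Filter F} (f : T -> R) (g : T -> E) (r : R) (a : E) :
  f @ F --> r -> g @ F --> a -> (fun x => f x *: g x) @ F --> r *: a.
Proof.
move=> fr ga.
apply: (@cvg_comp2 _ R^o _ _ _ (nbhs (r : R^o)) _ (nbhs (r *: a))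
  _ _ _ _ _ *:%R fr ga).
exact: (@scale_continuous R E (_, _)).
Qed.

Lemma cvg_line (R : realType) (E : tvsType R) (a v : E) :
  (fun h : R => h *: v + a) @ (0 : R) --> a.
Proof.
have -> : nbhs a = nbhs ((0 : R) *: v + a) by rewrite scale0r add0r.
apply: tvs_cvgD; last exact: cvg_cst.
by apply: tvs_cvgZ; [exact: cvg_id | exact: cvg_cst].
Qed.

Lemma cvg_dnbhs0_mulr (R : realType) (c : R) :
  c != 0 -> (fun h : R => h * c) @ (0 : R)^' --> (0 : R)^'.
Proof.
move=> c0 P /nbhs_ballP[e /= e0 He]; apply/nbhs_ballP.
exists (e / `|c|) => /=; first by rewrite divr_gt0 // normr_gt0.
move=> h; rewrite /ball /= sub0r normrN ltr_pdivlMr ?normr_gt0 // => he h0.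
by apply: He; [rewrite /ball /= sub0r normrN normrM | rewrite /= mulf_neq0].
Qed.

Lemma cvg_dline (R : realType) (E : tvsType R) (a v : E) :
  (fun h : R => h *: v + a) @ (0 : R)^' --> a.
Proof. by move=> A /(@cvg_line R E a v) H; apply: nbhs_dnbhs. Qed.

Lemma is_dir_derive_near (R : realType) (E F : tvsType R) (f g : E -> F) a v l :
  (\forall y \near a, f y = g y) ->
  is_dir_derive f a v l -> is_dir_derive g a v l.
Proof.
move=> fg; rewrite /is_dir_derive => fl; apply: cvg_trans fl.
apply: near_eq_cvg.
have fgh : \forall h \near (0 : R)^', f (h *: v + a) = g (h *: v + a).
  exact: (@cvg_dline R E a v _ fg).
by near=> h; rewrite (nbhs_singleton fg) (near fgh h).
Unshelve. all: by end_near. Qed.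

Lemma near_eq_dir_derive (R : realType) (E F : tvsType R) (f g : E -> F) a v :
  (\forall y \near a, f y = g y) -> dir_derive f a v = dir_derive g a v.
Proof.
move=> fg; congr (xget 0 _); apply/seteqP; split => l.
  exact: is_dir_derive_near.
by apply: is_dir_derive_near; apply: filterS fg => y ->.
Qed.

Lemma is_dir_derive_cst (R : realType) (E F : tvsType R) (c : F) (a v : E) :
  is_dir_derive (fun=> c) a v 0.
Proof.
apply: (@cvg_trans _ ((fun=> (0 : F)) @ (0 : R)^')); last exact: cvg_cst.
by apply: near_eq_cvg; near=> h; rewrite subrr scaler0.
Unshelve. all: by end_near. Qed.

Lemma is_dir_derive_pair (R : realType) (E F1 F2 : tvsType R) (f : E -> F1)
    (g : E -> F2) a v l m :
  is_dir_derive f a v l -> is_dir_derive g a v m ->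
  is_dir_derive (fun x => (f x, g x)) a v (l, m).
Proof. by move=> fl gm; apply: cvg_pair fl gm. Qed.

Lemma is_dir_derive_linear (R : realType) (E F : tvsType R) (L : E -> F) a v :
  (forall c u v, L (c *: u + v) = c *: L u + L v) -> is_dir_derive L a v (L v).
Proof.
move=> linL; apply: (@cvg_trans _ ((fun=> L v) @ (0 : R)^'));
  last exact: cvg_cst.
apply: near_eq_cvg; near=> h; rewrite linL addrK scalerA mulVf ?scale1r//.
by near: h; exact: nbhs_dnbhs_neq.
Unshelve. all: by end_near. Qed.

(** The derivative is continuous at (a, w), hence stays in a convex
    neighbourhood of its value there along all short segments from points near
    a in directions near w; the mean value inequality then bounds the difference
    quotients uniformly in the base point and the direction. *)
Lemma strict_slope (R : realType) (E F : tvsType R) (U : set E) (f : E -> F)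
    (a w : E) (D : set F) : open U -> Ck_on 1 U f -> U a ->
  nbhs (dir_derive f a w) D ->
  exists (d : R) (A W : set E), [/\ 0 < d, nbhs a A, nbhs w W &
    forall t x v, `|t| < d -> t != 0 -> A x -> W v ->
      D (t^-1 *: (f (t *: v + x) - f x))].
Proof.
move=> oU [_ [df [cdf _]]] Ua /nbhs_convex_open[C [oC Cl cC CD]].
have cv : (fun p : R * (E * E) => (p.1 *: p.2.2 + p.2.1, p.2.2)) @
    ((0 : R), (a, w)) --> (a, w).
  apply: (@cvg_pair _ _ _ _ (nbhs a) (nbhs w));
    last exact: cvg_comp cvg_snd cvg_snd.
  have -> : nbhs a = nbhs ((0 : R) *: w + a) by rewrite scale0r add0r.
  apply: tvs_cvgD; last exact: cvg_comp cvg_snd cvg_fst.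
  by apply: tvs_cvgZ; [exact: cvg_fst | exact: cvg_comp cvg_snd cvg_snd].
have Naw : nbhs (a, w) [set p : E * E | U p.1 /\ C (dir_derive f p.1 p.2)].
  apply: filterI.
    exists (U, setT); last by move=> ? [].
    by split; [exact: open_nbhs_nbhs | exact: filterT].
  by apply: (cdf (a, w)) => //; exact: open_nbhs_nbhs.
have [[B1 B2] /= [/nbhs_ballP[d /= d0 dB1] [[A W] /= [Aa Ww] AWB2]] sub] :=
  cv _ Naw.
exists d, A, W; split => // t x v td t0 Ax Wv; apply: CD.
have inC s : 0 <= s <= 1 ->
    U (s *: (t *: v) + x) /\ C (dir_derive f (s *: (t *: v) + x) v).
  move=> /andP[s0 s1]; rewrite scalerA.
  apply: (sub (s * t, (x, v))); split; last exact: AWB2.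
  apply: dB1; rewrite /ball /= sub0r normrN normrM (ger0_norm s0).
  by rewrite (le_lt_trans _ td) // ler_piMl.
pose phi (s : R) := t^-1 *: f (s *: (t *: v) + x).
have := @mean_value_convex R F C phi cC.
rewrite /phi scale1r scale0r add0r -scalerBr; apply=> s /inC[Us Cs].
have := dir_deriveP (df _ v Us); set l := dir_derive _ _ _ in Cs *.
move=> lim; have ht := cvg_dnbhs0_mulr t0.
have H : \forall h \near (0 : R)^', C ((h * t)^-1 *:
    (f ((h * t) *: v + (s *: (t *: v) + x)) - f (s *: (t *: v) + x))).
  exact: ht _ (lim _ (open_nbhs_nbhs (conj oC Cs))).
near=> h; rewrite -scalerBr [h^-1 *: _]scalerA -invfM scalerDl -addrA.
rewrite [h *: (t *: v)]scalerA.
by rewrite addrCA; exact: (near H h).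
Unshelve. all: by end_near. Qed.

(** Writing g (h v + a) = g a + h l_h with l_h --> l turns the difference
    quotient of f \o g into one of f at g a whose direction l_h moves with h. *)
Lemma is_dir_derive_comp (R : realType) (X E F : tvsType R) (U : set E)
    (f : E -> F) (g : X -> E) a v l : open U -> Ck_on 1 U f -> U (g a) ->
  is_dir_derive g a v l ->
  is_dir_derive (f \o g) a v (dir_derive f (g a) l).
Proof.
move=> oU fC1 Uga gl D /(strict_slope oU fC1 Uga)[d [A [W [d0 Aa Wl HD]]]].
have := gl _ Wl; rewrite /= => W'.
suff : \forall h \near (0 : R)^',
    D (h^-1 *: (f (g (h *: v + a)) - f (g a))) by [].
near=> h.
have h0 : h != 0 by near: h; exact: nbhs_dnbhs_neq.
have -> : g (h *: v + a) = h *: (h^-1 *: (g (h *: v + a) - g a)) + g a.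
  by rewrite scalerA divff // scale1r subrK.
apply: HD => //; last by near: h.
  near: h; apply: nbhs_dnbhs; apply/nbhs_ballP; exists d => //= h.
  by rewrite /ball /= sub0r normrN.
exact: nbhs_singleton.
Unshelve. all: by end_near. Qed.

Lemma is_dir_deriveZ (R : realType) (E F : tvsType R) (f : E -> F) a v l
    (c : R) :
  is_dir_derive f a v l -> is_dir_derive f a (c *: v) (c *: l).
Proof.
have [-> _|c0 fl] := eqVneq c 0.
  rewrite !scale0r /is_dir_derive.
  apply: (@cvg_trans _ ((fun=> (0 : F)) @ (0 : R)^')).
    by apply: near_eq_cvg; near=> h; rewrite scaler0 add0r subrr scaler0.
  exact: cvg_cst.
have hc := cvg_dnbhs0_mulr c0.
have H : (fun h : R => c *: ((h * c)^-1 *: (f ((h * c) *: v + a) - f a)))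
    @ (0 : R)^' --> c *: l.
  by apply: tvs_cvgZ; [exact: cvg_cst | exact: cvg_comp hc fl].
apply: (cvg_trans _ H); apply: near_eq_cvg; near=> h => /=.
by rewrite [h *: (c *: v)]scalerA [c *: _]scalerA invfM mulrCA divff // mulr1.
Unshelve. all: by end_near. Qed.

(** Additivity splits the difference quotient in the direction c u + v at the
    moving point a + h v, where strict differentiability applies. *)
Lemma dir_derive_linear (R : realType) (E F : tvsType R) (U : set E)
    (f : E -> F) a : hausdorff_space F -> open U -> Ck_on 1 U f -> U a ->
  forall c u v,
  dir_derive f a (c *: u + v) = c *: dir_derive f a u + dir_derive f a v.
Proof.
move=> hF oU fC1 Ua c u v; apply: dir_derive_unique => //.
have [_ [df _]] := fC1.
have Du := dir_deriveP (df a (c *: u) Ua); have Dv := dir_deriveP (df a v Ua).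
have Zu : is_dir_derive f a (c *: u) (c *: dir_derive f a u).
  by apply: is_dir_deriveZ; exact: dir_deriveP (df a u Ua).
rewrite -(dir_derive_unique hF Zu).
apply: (@cvg_trans _ ((fun h : R =>
   h^-1 *: (f (h *: (c *: u) + (h *: v + a)) - f (h *: v + a))
   + h^-1 *: (f (h *: v + a) - f a)) @ (0 : R)^')).
  apply: near_eq_cvg; near=> h.
  by rewrite -scalerDr subrKA [h *: (_ + v)]scalerDr addrA.
apply: tvs_cvgD; last exact: Dv.
move=> D /(strict_slope oU fC1 Ua)[d [A [W [d0 Aa Wl HD]]]].
suff : \forall h \near (0 : R)^',
  D (h^-1 *: (f (h *: (c *: u) + (h *: v + a)) - f (h *: v + a))) by [].
near=> h; apply: HD.
- near: h; apply: nbhs_dnbhs; apply/nbhs_ballP; exists d => //= h.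
  by rewrite /ball /= sub0r normrN.
- by near: h; exact: nbhs_dnbhs_neq.
- by near: h; exact: (@cvg_dline R E a v _ Aa).
- exact: nbhs_singleton.
Unshelve. all: by end_near. Qed.

(** * The classes C^k and smooth maps *)

Lemma near_eq_continuous (S T : topologicalType) (f g : S -> T) (x : S) :
  (\forall y \near x, f y = g y) -> {for x, continuous f} ->
  {for x, continuous g}.
Proof.
move=> fg fx; have fgx := nbhs_singleton fg; rewrite /= in fgx.
rewrite /prop_for /continuous_at -fgx.
apply: cvg_trans fx; apply: near_eq_cvg.
by near=> y; rewrite (near fg y).
Unshelve. all: by end_near. Qed.

Lemma Ck_onS (R : realType) k (E F : tvsType R) (U : set E) (f : E -> F) :
  Ck_on k.+1 U f -> Ck_on k U f.
Proof.
elim: k E F U f => [|k IH] E F U f; first by case.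
by move=> [fc [df dC]]; split => //; split => //; exact: IH.
Qed.

Lemma Ck_on1 (R : realType) k (E F : tvsType R) (U : set E) (f : E -> F) :
  Ck_on k.+1 U f -> Ck_on 1 U f.
Proof. by elim: k => // k IH /Ck_onS. Qed.

Lemma Ck_on_local (R : realType) k (E F : tvsType R) (U : set E) (f : E -> F) :
  (forall x, U x -> exists2 V, V x & Ck_on k V f) -> Ck_on k U f.
Proof.
elim: k E F U f => [|k IH] E F U f loc; split=> //.
- by move=> x /loc[V Vx [+ _]]; apply.
- by move=> x /loc[V Vx [+ _]]; apply.
split=> [x v /loc[V Vx [_ [+ _]]]|]; first exact.
apply: IH => -[x v] [/= /loc[V Vx [_ [_ dC]]] _].
by exists (V `*` setT).
Qed.

Lemma Ck_on_subset (R : realType) k (E F : tvsType R) (U V : set E)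
    (f : E -> F) :
  V `<=` U -> Ck_on k U f -> Ck_on k V f.
Proof. by move=> VU fC; apply: Ck_on_local => x /VU Ux; exists U. Qed.

Lemma eq_Ck_on (R : realType) k (E F : tvsType R) (U : set E) (f g : E -> F) :
  open U -> (forall x, U x -> f x = g x) -> Ck_on k U f -> Ck_on k U g.
Proof.
elim: k E F U f g => [|k IH] E F U f g oU fg.
  move=> [fc _]; split=> // x Ux; apply: near_eq_continuous (fc x Ux).
  by apply: filterS (open_nbhs_nbhs (conj oU Ux)) => y /fg.
have nfg x : U x -> \forall y \near x, f y = g y.
  by move=> Ux; apply: filterS (open_nbhs_nbhs (conj oU Ux)) => y /fg.
move=> [fc [df dC]]; split=> [x Ux|].
  exact: near_eq_continuous (nfg _ Ux) (fc x Ux).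
split=> [x v Ux|].
  have [l fl] := df x v Ux; exists l; exact: is_dir_derive_near (nfg _ Ux) fl.
apply: IH dC; first exact: setXT_open.
by move=> [x v] [/= Ux _]; exact: near_eq_dir_derive (nfg _ Ux).
Qed.

Lemma Ck_on_pair (R : realType) k (E F1 F2 : tvsType R) (U : set E)
    (f : E -> F1) (g : E -> F2) : hausdorff_space F1 -> hausdorff_space F2 ->
  open U -> Ck_on k U f -> Ck_on k U g -> Ck_on k U (fun x => (f x, g x)).
Proof.
move=> hF1 hF2; elim: k E U f g => [|k IH] E U f g oU.
  move=> [fc _] [gc _]; split=> // x Ux.
  exact: cvg_pair (fc x Ux) (gc x Ux).
move=> [fc [df dfC]] [gc [dg dgC]]; split=> [x Ux|].
  exact: cvg_pair (fc x Ux) (gc x Ux).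
have dfg x v : U x -> is_dir_derive (fun x => (f x, g x)) x v
    (dir_derive f x v, dir_derive g x v).
  by move=> Ux; apply: is_dir_derive_pair; apply: dir_deriveP; auto.
split=> [x v Ux|].
  by exists (dir_derive f x v, dir_derive g x v); exact: dfg.
have oUT : open (U `*` [set: E]) by exact: setXT_open.
apply: (eq_Ck_on oUT _ (IH _ _ _ _ oUT dfC dgC)) => -[x v] [/= Ux _].
by rewrite (dir_derive_unique _ (dfg x v Ux)) //; exact: prod_hausdorff.
Qed.

Lemma Ck_on_linear (R : realType) k (E F : tvsType R) (L : E -> F) :
  hausdorff_space F -> (forall c u v, L (c *: u + v) = c *: L u + L v) ->
  continuous L -> Ck_on k setT L.
Proof.
move=> hF; elim: k E L => [|k IH] E L linL cL;
  (split; first by move=> x _; exact: cL) => //.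
split=> [x v _|]; first by exists (L v); exact: is_dir_derive_linear.
have -> : (fun p : E * E => dir_derive L p.1 p.2) = L \o snd.
  apply/funext => -[x v]; apply: dir_derive_unique => //.
  exact: is_dir_derive_linear.
apply: Ck_on_subset (@subsetT _ _) (IH _ _ _ _).
  by move=> c u v /=; rewrite linL.
by move=> p; apply: continuous_comp; [exact: cvg_snd | exact: cL].
Qed.

(** The derivative of a composite is the composite of the derivative of the
    outer map with the tangent map (x, v) |-> (f x, df x v) of the inner one,
    so the class C^k is stable under composition by induction on k, over all
    spaces at once. *)
Lemma Ck_on_comp (R : realType) k (E F G : tvsType R) (U : set E) (V : set F)
    (f : E -> F) (g : F -> G) :
  hausdorff_space E -> hausdorff_space F -> hausdorff_space G ->
  open U -> open V -> (forall x, U x -> V (f x)) ->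
  Ck_on k U f -> Ck_on k V g -> Ck_on k U (g \o f).
Proof.
elim: k E F G U V f g => [|k IH] E F G U V f g hE hF hG oU oV UV.
  move=> [fc _] [gc _]; split=> // x Ux.
  by apply: continuous_comp; [exact: fc | exact: gc (UV _ Ux)].
move=> fC gC; have [fc [df dfC]] := fC; have [gc [dg dgC]] := gC.
have dgf x v : U x ->
    is_dir_derive (g \o f) x v (dir_derive g (f x) (dir_derive f x v)).
  move=> Ux; apply: is_dir_derive_comp (Ck_on1 gC) (UV _ Ux) _ => //.
  exact: dir_deriveP (df x v Ux).
split=> [x Ux|].
  by apply: continuous_comp; [exact: fc | exact: gc (UV _ Ux)].
split=> [x v Ux|]; first by eexists; exact: dgf.
have oUT : open (U `*` [set: E]) by exact: setXT_open.
have oVT : open (V `*` [set: F]) by exact: setXT_open.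
pose Tf (p : E * E) := (f p.1, dir_derive f p.1 p.2).
have TfC : Ck_on k (U `*` setT) Tf.
  apply: Ck_on_pair => //.
  apply: (IH _ _ _ _ U fst f) => //; first exact: prod_hausdorff.
  - by move=> p [].
  - apply: Ck_on_subset (@subsetT _ _) (Ck_on_linear _ hE _ _) => //.
    by move=> p; exact: cvg_fst.
  - exact: Ck_onS.
have hEE := prod_hausdorff hE hE; have hFF := prod_hausdorff hF hF.
have := IH _ _ _ _ _ Tf _ hEE hFF hG oUT oVT _ TfC dgC.
have UVT p : (U `*` setT) p -> (V `*` setT) (Tf p) by move=> [/UV].
move=> /(_ UVT); apply: eq_Ck_on => // -[x v] [/= Ux _].
by rewrite /Tf /= (dir_derive_unique hG (dgf x v Ux)).
Qed.

Lemma regular_hausdorff (R : realType) : hausdorff_space R^o.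
Proof. exact: Rhausdorff. Qed.

Lemma quadratic_dir_derive (R : realType) (E : tvsType R) (q : E -> R)
    (b : E -> E -> R) x v : continuous (q : E -> R^o) ->
  (forall a u v w, b (a *: u + v) w = a * b u w + b v w) ->
  (forall u v, b u v = b v u) -> (forall v, q v = b v v) ->
  is_dir_derive (q : E -> R^o) x v (2 * b x v : R^o).
Proof.
move=> qc bl bs qb.
have H : (fun h : R => (2 * b x v + h * q v : R^o)) @ (0 : R)^' -->
    (2 * b x v : R^o).
  have -> : nbhs (2 * b x v : R^o) = nbhs (2 * b x v + 0 * q v : R^o).
    by rewrite mul0r addr0.
  apply: (@tvs_cvgD R R^o); first exact: cvg_cst.
  apply: (@tvs_cvgZ R R^o); last exact: cvg_cst.
  exact: nbhs_dnbhs.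
apply: cvg_trans H; apply: near_eq_cvg; near=> h.
have h0 : h != 0 by near: h; exact: nbhs_dnbhs_neq.
rewrite !qb bl (bs v (_ + _)) (bs x (_ + _)) !bl (bs v x).
by rewrite /GRing.scale /=; field.
Unshelve. all: by end_near. Qed.

(** By induction, since the derivative (x, v) |-> 2 b x v is itself continuous
    and quadratic: it equals q (x + v) - q x - q v. *)
Lemma Ck_on_quadratic (R : realType) k (E : tvsType R) (q : E -> R) :
  continuous (q : E -> R^o) -> quadratic_form q -> Ck_on k setT (q : E -> R^o).
Proof.
elim: k E q => [|k IH] E q cq qf;
  (split; first by move=> x _; exact: cq) => //; have [b [bl bs qb]] := qf.
have dq x v := @quadratic_dir_derive R E q b x v cq bl bs qb.
split=> [x v _|]; first by exists (2 * b x v); exact: dq.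
have br a u v w : b w (a *: u + v) = a * b w u + b w v.
  by rewrite bs bl (bs u) (bs v).
have -> : (fun p : E * E => dir_derive (q : E -> R^o) p.1 p.2) =
    (fun p => (2 * b p.1 p.2)).
  apply/funext => -[x v].
  apply: dir_derive_unique; first exact: regular_hausdorff.
  exact: dq.
apply: Ck_on_subset (@subsetT _ _) (IH _ _ _ _).
  have -> : (fun p : E * E => 2 * b p.1 p.2) =
      (fun p => q (p.1 + p.2) + (- 1 *: (q p.1 : R^o) + - 1 *: (q p.2 : R^o))).
    apply/funext => -[x v] /=.
    have bD u v' w : b (u + v') w = b u w + b v' w.
      by rewrite -[u in LHS]scale1r bl mul1r.
    rewrite !qb bD !(bs _ (x + v)) !bD (bs v x).
    by rewrite /GRing.scale /=; ring.
  move=> p; apply: (@tvs_cvgD R R^o).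
    apply: (@cvg_comp _ _ _ (fun p : E * E => p.1 + p.2) q _
      (nbhs (p.1 + p.2))).
      exact: add_continuous.
    exact: cq.
  apply: (@tvs_cvgD R R^o); apply: (@tvs_cvgZ R R^o); try exact: cvg_cst.
    exact: (@continuous_comp _ _ R^o fst q p cvg_fst (cq _)).
  exact: (@continuous_comp _ _ R^o snd q p cvg_snd (cq _)).
exists (fun p p' => b p.1 p'.2 + b p'.1 p.2); split.
- by move=> a u v w /=; rewrite bl br; ring.
- by move=> u v; rewrite addrC.
- by move=> v; ring.
Qed.

Lemma smooth_on_derivable (R : realType) (E F : tvsType R) (U : set E)
    (f : E -> F) x v : smooth_on U f -> U x -> dir_derivable f x v.
Proof. by move=> [_ /(_ 1%N)[_ [+ _]]] Ux; apply. Qed.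

Lemma smooth_on_continuous (R : realType) (E F : tvsType R) (U : set E)
    (f : E -> F) x : smooth_on U f -> U x -> {for x, continuous f}.
Proof. by move=> [_ /(_ 0%N)[+ _]] Ux; apply. Qed.

Lemma smooth_on_local (R : realType) (E F : tvsType R) (U : set E)
    (f : E -> F) :
  (forall x, U x -> exists V g, [/\ V `<=` U, V x, smooth_on V g &
     forall y, V y -> g y = f y]) -> smooth_on U f.
Proof.
move=> loc; split.
  rewrite openE => x /loc[V [g [VU Vx [oV _] _]]].
  by apply: filterS VU _; exact: open_nbhs_nbhs.
move=> k; apply: Ck_on_local => x /loc[V [g [VU Vx [oV gC] gf]]].
by exists V => //; exact: eq_Ck_on oV gf (gC k).
Qed.

Lemma eq_smooth_on (R : realType) (E F : tvsType R) (U : set E) (f g : E -> F) :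
  (forall x, U x -> f x = g x) -> smooth_on U f -> smooth_on U g.
Proof. by move=> fg [oU fC]; split=> // k; exact: eq_Ck_on (fC k). Qed.

Lemma smooth_on_subset (R : realType) (E F : tvsType R) (U V : set E)
    (f : E -> F) : open V -> V `<=` U -> smooth_on U f -> smooth_on V f.
Proof. by move=> oV VU [oU fC]; split=> // k; exact: Ck_on_subset (fC k). Qed.

Lemma smooth_on_pair (R : realType) (E F1 F2 : tvsType R) (U : set E)
    (f : E -> F1) (g : E -> F2) : hausdorff_space F1 -> hausdorff_space F2 ->
  smooth_on U f -> smooth_on U g -> smooth_on U (fun x => (f x, g x)).
Proof. by move=> h1 h2 [oU fC] [_ gC]; split=> // k; exact: Ck_on_pair. Qed.

Lemma smooth_on_linear (R : realType) (E F : tvsType R) (L : E -> F) :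
  hausdorff_space F -> (forall c u v, L (c *: u + v) = c *: L u + L v) ->
  continuous L -> smooth_on setT L.
Proof.
by move=> hF lL cL; split; [exact: openT | move=> k; exact: Ck_on_linear].
Qed.

Lemma smooth_on_fst (R : realType) (E F : tvsType R) :
  hausdorff_space E -> smooth_on setT (@fst E F).
Proof.
by move=> hE; apply: smooth_on_linear => // p; exact: cvg_fst.
Qed.

Lemma smooth_on_snd (R : realType) (E F : tvsType R) :
  hausdorff_space F -> smooth_on setT (@snd E F).
Proof.
by move=> hE; apply: smooth_on_linear => // p; exact: cvg_snd.
Qed.

Lemma smooth_on_id (R : realType) (E : tvsType R) :
  hausdorff_space E -> smooth_on setT (@id E).
Proof.
by move=> hE; apply: smooth_on_linear => // p; exact: cvg_id.
Qed.

Lemma Ck_on_cst (R : realType) k (E F : tvsType R) (U : set E) (c : F) :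
  hausdorff_space F -> Ck_on k U (fun=> c).
Proof.
move=> hF; elim: k E U c => [|k IH] E U c;
  (split; first by move=> x _; exact: cvg_cst) => //.
split=> [x v _|]; first by exists 0; exact: is_dir_derive_cst.
have -> : (fun p : E * E => dir_derive (fun=> c) p.1 p.2) = (fun=> 0).
  apply/funext => p; apply: dir_derive_unique => //; exact: is_dir_derive_cst.
exact: IH.
Qed.

Lemma smooth_on_cst (R : realType) (E F : tvsType R) (U : set E) (c : F) :
  hausdorff_space F -> open U -> smooth_on U (fun=> c).
Proof. by move=> hF oU; split=> // k; exact: Ck_on_cst. Qed.

Lemma continuous_preimage_open (S T : topologicalType) (U : set S) (V : set T)
    (f : S -> T) : open U -> open V ->
  (forall x, U x -> {for x, continuous f}) -> open (U `&` f @^-1` V).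
Proof.
move=> oU oV cf; rewrite openE => x [Ux Vfx]; apply: filterI.
  exact: open_nbhs_nbhs.
by apply: (cf x Ux); exact: open_nbhs_nbhs.
Qed.

Lemma smooth_on_comp (R : realType) (E F G : tvsType R) (U : set E) (V : set F)
    (f : E -> F) (g : F -> G) :
  hausdorff_space E -> hausdorff_space F -> hausdorff_space G ->
  smooth_on U f -> smooth_on V g -> smooth_on (U `&` f @^-1` V) (g \o f).
Proof.
move=> hE hF hG fS [oV gC]; have [oU fC] := fS.
have oUV : open (U `&` f @^-1` V).
  by apply: continuous_preimage_open => // x; exact: smooth_on_continuous.
split=> // k; apply: (@Ck_on_comp R k E F G _ V) => //; first by move=> x [].
by apply: Ck_on_subset (fC k) => x [].
Qed.

Lemma smooth_on_derive (R : realType) (E F : tvsType R) (U : set E)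
    (f : E -> F) : smooth_on U f ->
  smooth_on (U `*` setT) (fun p => dir_derive f p.1 p.2).
Proof.
move=> [oU fC]; split; first exact: setXT_open.
by move=> k; have [_ []] := fC k.+1.
Qed.

Lemma dir_derive_comp (R : realType) (X E F : tvsType R) (U : set E)
    (f : E -> F) (g : X -> E) a v : hausdorff_space F -> smooth_on U f ->
  U (g a) -> dir_derivable g a v ->
  dir_derive (f \o g) a v = dir_derive f (g a) (dir_derive g a v).
Proof.
move=> hF [oU fC] Uga dg; apply: dir_derive_unique => //.
exact: is_dir_derive_comp (fC 1%N) Uga (dir_deriveP dg).
Qed.

(** On a convex neighbourhood V of x, the increment f y - f x lies in every
    convex neighbourhood of 0 by the mean value inequality along the segment
    from x to y, hence vanishes. *)
Lemma zero_derivative_locally_constant (R : realType) (E F : tvsType R)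
    (U : set E) (f : E -> F) : hausdorff_space F -> open U ->
  (forall x v, U x -> is_dir_derive f x v 0) ->
  forall x, U x -> exists V, [/\ open V, V x, V `<=` U &
    forall y, V y -> f y = f x].
Proof.
move=> hF oU df x Ux.
have [V [oV Vx cV VU]] := nbhs_convex_open (open_nbhs_nbhs (conj oU Ux)).
exists V; split=> // y Vy; apply/eqP; rewrite -subr_eq0; apply/eqP.
apply: (@cvg_unique F hF ((fun=> f y - f x) @ nbhs (0 : R))).
  exact: cvg_cst.
move=> D /nbhs_convex_open[C [oC C0 cC CD]].
suff /CD Df : C (f y - f x).
  by apply: (@filterE _ (nbhs (0 : R))) => r; exact: Df.
pose phi (s : R) := f (s *: (y - x) + x).
have := @mean_value_convex R F C phi cC.
rewrite /phi scale1r scale0r add0r subrK; apply=> s s01.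
have Us : U (s *: (y - x) + x).
  have -> : s *: (y - x) + x = s *: y + (1 - s) *: x.
    by rewrite scalerBl scale1r scalerBr addrA addrAC.
  by apply: VU; exact: cV.
have H := df _ (y - x) Us C (open_nbhs_nbhs (conj oC C0)).
near=> h; rewrite [s + h]addrC scalerDl -addrA.
suff : C (h^-1 *: (f (h *: (y - x) + (s *: (y - x) + x))
    - f (s *: (y - x) + x))) by [].
by near: h; exact: H.
Unshelve. all: by end_near. Qed.

(** * Smooth maps into manifolds and their velocities *)

Section ManifoldTheory.
Variables (R : realType) (E : tvsType R) (M : Type) (mM : manifold E M).

Lemma image_chartI (x : M) (A : set M) :
  chart mM x @` (dom mM x `&` A) =
  chart mM x @` dom mM x `&` chart_inv mM x @^-1` A.
Proof.
apply/seteqP; split => [_ [m [dm Am] <-]|_ [[m dm <-] /=]].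
  by split; [exists m | rewrite /= chartK].
by rewrite chartK // => Am; exists m.
Qed.

Lemma chart_invK (x : M) (u : E) :
  (chart mM x @` dom mM x) u -> chart mM x (chart_inv mM x u) = u.
Proof. by move=> [m dm <-]; rewrite chartK. Qed.

Lemma mem_chart (x : M) : (chart mM x @` dom mM x) (chart mM x x).
Proof. by exists x => //; exact: mem_dom. Qed.

Lemma chart_inv_chart (x : M) : chart_inv mM x (chart mM x x) = x.
Proof. by rewrite chartK //; exact: mem_dom. Qed.

Lemma chart_range_open (x : M) : open (chart mM x @` dom mM x).
Proof. by have [] := smooth_transition mM x x; rewrite setIid. Qed.

(** Inverse charts, maps of manifolds read in a chart of the source, and
    products of such maps in a Lie group are all smooth maps from an open subset
    of a locally convex space, so one notion serves for all of them. *)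
Definition plot (X : tvsType R) (U : set X) (phi : X -> M) : Prop :=
  forall y, smooth_on (U `&` phi @^-1` dom mM y) (chart mM y \o phi).

(** The chart at phi a is the one that identifies the tangent space at phi a
    with the model space. *)
Definition velocity (X : tvsType R) (phi : X -> M) (a v : X) : E :=
  dir_derive (chart mM (phi a) \o phi) a v.

Lemma plot_near_dom (X : tvsType R) (U : set X) (phi : X -> M) a :
  plot U phi -> U a -> nbhs a (U `&` phi @^-1` dom mM (phi a)).
Proof.
move=> pphi Ua; have [oU _] := pphi (phi a).
by apply: open_nbhs_nbhs; split => //; split => //; exact: mem_dom.
Qed.

Lemma plot_open (X : tvsType R) (U : set X) (phi : X -> M) :
  plot U phi -> open U.
Proof.
move=> pphi; rewrite openE => x /(plot_near_dom pphi).
by apply: filterS => y [].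
Qed.

Lemma plot_chart_inv (x : M) : plot (chart mM x @` dom mM x) (chart_inv mM x).
Proof. by move=> y; rewrite -image_chartI; exact: smooth_transition. Qed.

Lemma plot_comp (X Y : tvsType R) (U : set X) (V : set Y) (phi : X -> M)
    (s : Y -> X) : hausdorff_space X -> hausdorff_space Y ->
  plot U phi -> smooth_on V s -> plot (V `&` s @^-1` U) (phi \o s).
Proof.
move=> hX hY pphi sS y; rewrite -setIA.
exact: smooth_on_comp hY hX (model_hausdorff mM) sS (pphi y).
Qed.

Lemma plot_subset (X : tvsType R) (U V : set X) (phi : X -> M) :
  open V -> V `<=` U -> plot U phi -> plot V phi.
Proof.
move=> oV VU pphi y; apply: smooth_on_subset (pphi y); last by move=> u [/VU].
have -> : V `&` phi @^-1` dom mM y = V `&` (U `&` phi @^-1` dom mM y).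
  apply/seteqP; split=> u [Vu]; last by case.
  by move=> ?; split=> //; split=> //; exact: VU.
by apply: openI => //; case: (pphi y).
Qed.

Lemma plot_cst (X : tvsType R) (U : set X) (m : M) :
  open U -> plot U (fun=> m).
Proof.
move=> oU y; apply: smooth_on_cst; first exact: model_hausdorff mM.
have [dm|ndm] := pselect (dom mM y m).
  suff -> : U `&` (fun=> m) @^-1` dom mM y = U by [].
  by apply/seteqP; split=> u // [].
suff -> : U `&` (fun=> m) @^-1` dom mM y = set0 by exact: open0.
by apply/seteqP; split=> u // [].
Qed.

Lemma near_eq_velocity (X : tvsType R) (phi psi : X -> M) a v :
  (\forall y \near a, phi y = psi y) -> velocity phi a v = velocity psi a v.
Proof.
move=> e; rewrite /velocity (nbhs_singleton e); apply: near_eq_dir_derive.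
by apply: filterS e => y /= ->.
Qed.

Lemma eq_velocity (X : tvsType R) (phi psi : X -> M) a v :
  phi =1 psi -> velocity phi a v = velocity psi a v.
Proof. by move=> /funext ->. Qed.

Lemma velocity_comp (X Y : tvsType R) (U : set X) (phi : X -> M) (s : Y -> X)
    a v : plot U phi -> U (s a) -> dir_derivable s a v ->
  velocity (phi \o s) a v = velocity phi (s a) (dir_derive s a v).
Proof.
move=> pphi Usa ds.
apply: (dir_derive_comp (model_hausdorff mM) (pphi (phi (s a)))) => //.
by split => //; exact: mem_dom.
Qed.

Lemma velocity_linear (X : tvsType R) (U : set X) (phi : X -> M) a :
  plot U phi -> U a -> forall c u v,
  velocity phi a (c *: u + v) = c *: velocity phi a u + velocity phi a v.
Proof.
move=> pphi Ua; have [oU] := pphi (phi a) => /(_ 1%N) C1.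
apply: (dir_derive_linear (model_hausdorff mM) oU C1).
by split=> //; exact: mem_dom.
Qed.

Lemma velocity_chart_inv (x : M) v :
  velocity (chart_inv mM x) (chart mM x x) v = v.
Proof.
rewrite /velocity chartK; last exact: mem_dom.
rewrite (@near_eq_dir_derive _ _ _ _ id).
  apply: dir_derive_unique; first exact: model_hausdorff mM.
  by apply: is_dir_derive_linear.
apply: filterS (open_nbhs_nbhs (conj (chart_range_open x) (mem_chart x))) => u.
by move=> /chart_invK.
Qed.

End ManifoldTheory.

Section SmoothMaps.
Variables (R : realType) (E F : tvsType R) (M N : Type).
Variables (mM : manifold E M) (mN : manifold F N).

Lemma smooth_map_onE (W : set M) (f : M -> N) :
  smooth_map_on mM mN W f <->
  forall x, plot mN (chart mM x @` (dom mM x `&` W)) (f \o chart_inv mM x).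
Proof.
have e x y : chart mM x @` (dom mM x `&` W `&` f @^-1` dom mN y) =
    chart mM x @` (dom mM x `&` W) `&` (f \o chart_inv mM x) @^-1` dom mN y.
  by rewrite -setIA !image_chartI -setIA.
by split=> h x y; move: (h x y); rewrite e.
Qed.

Lemma smooth_mapE (f : M -> N) : smooth_map mM mN f <->
  forall x, plot mN (chart mM x @` dom mM x) (f \o chart_inv mM x).
Proof.
rewrite /smooth_map smooth_map_onE.
by split=> h x; move: (h x); rewrite setIT.
Qed.

(** Near u, factor f \o phi through the chart at phi u. *)
Lemma plot_push (X : tvsType R) (U : set X) (W : set M) (phi : X -> M)
    (f : M -> N) : hausdorff_space X -> smooth_map_on mM mN W f ->
  plot mM U phi -> (forall u, U u -> W (phi u)) -> plot mN U (f \o phi).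
Proof.
move=> hX fS pphi UW z; apply: smooth_on_local => u [Uu zu].
have S1 := pphi (phi u); have S2 := fS (phi u) z.
exists (U `&` phi @^-1` dom mM (phi u) `&` (chart mM (phi u) \o phi) @^-1`
   (chart mM (phi u) @` (dom mM (phi u) `&` W `&` f @^-1` dom mN z))).
have phiK w : dom mM (phi u) (phi w) ->
    chart_inv mM (phi u) (chart mM (phi u) (phi w)) = phi w.
  by move=> dw; rewrite chartK.
eexists; split; last 2 first.
- exact: (smooth_on_comp hX (model_hausdorff mM) (model_hausdorff mN) S1 S2).
- by move=> w [[_ /phiK e] _]; rewrite /= e.
- move=> w [[Uw /= dw]] [m [[dm _] zm] e]; split=> //=.
  by rewrite -(phiK _ dw) -e chartK.
- split; first by split => //; exact: mem_dom.
  by exists (phi u) => //; split=> //; split; [exact: mem_dom | exact: UW].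
Qed.

Lemma velocity_push (X : tvsType R) (U : set X) (W : set M) (phi : X -> M)
    (f : M -> N) a v : smooth_map_on mM mN W f -> plot mM U phi -> U a ->
  W (phi a) ->
  velocity mN (f \o phi) a v =
  tangent_map mM mN f (phi a) (velocity mM phi a v).
Proof.
move=> fS pphi Ua Wa; set x := phi a.
rewrite /tangent_map /velocity /= -/x.
rewrite (@near_eq_dir_derive _ _ _ _
   ((chart mN (f x) \o f \o chart_inv mM x) \o (chart mM x \o phi)));
  last first.
  apply: filterS (plot_near_dom pphi Ua) => y [_ /= dy].
  by rewrite chartK.
rewrite (dir_derive_comp (model_hausdorff mN) (fS x (f x))) //.
  exists x => //; split; last exact: mem_dom.
  by split => //; exact: mem_dom.
apply: (smooth_on_derivable _ (pphi x)).
by split=> //; exact: mem_dom.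
Qed.

(** A tangent map is the velocity of the image of an inverse chart; this
    reduces statements on tangent maps to statements on plots. *)
Lemma tangent_mapE (f : M -> N) x v :
  tangent_map mM mN f x v = velocity mN (f \o chart_inv mM x) (chart mM x x) v.
Proof. by rewrite /velocity /= chartK //; exact: mem_dom. Qed.

Lemma eq_tangent_map (f g : M -> N) x v :
  f =1 g -> tangent_map mM mN f x v = tangent_map mM mN g x v.
Proof. by move=> /funext ->. Qed.

Lemma tangent_map_linear (W : set M) (f : M -> N) x :
  smooth_map_on mM mN W f -> W x -> forall c u v,
  tangent_map mM mN f x (c *: u + v) =
  c *: tangent_map mM mN f x u + tangent_map mM mN f x v.
Proof.
move=> /smooth_map_onE fS Wx c u v; rewrite !tangent_mapE.
apply: (velocity_linear (fS x)).
by exists x => //; split=> //; exact: mem_dom.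
Qed.

End SmoothMaps.

Lemma tangent_map_comp (R : realType) (E F E' : tvsType R) (M N P : Type)
    (mM : manifold E M) (mN : manifold F N) (mP : manifold E' P) (W : set M)
    (f : M -> N) (g : N -> P) x v :
  smooth_map_on mM mN W f -> smooth_map mN mP g -> W x ->
  tangent_map mN mP g (f x) (tangent_map mM mN f x v) =
  tangent_map mM mP (g \o f) x v.
Proof.
move=> /smooth_map_onE fS gS Wx.
rewrite [RHS]tangent_mapE [tangent_map mM mN _ _ _]tangent_mapE.
have cx : (chart mM x @` (dom mM x `&` W)) (chart mM x x).
  by exists x => //; split=> //; exact: mem_dom.
by rewrite -[f x in LHS](congr1 f (chart_inv_chart mM x))
  -(velocity_push v gS (fS x) cx I).
Qed.


(** Constancy along every chart makes level sets open and closed. *)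
Lemma connected_constant (R : realType) (E F : tvsType R) (M : Type)
    (mM : manifold E M) (f : M -> F) : mconnected mM -> hausdorff_space F ->
  (forall x u v, (chart mM x @` dom mM x) u ->
     is_dir_derive (f \o chart_inv mM x) u v 0) ->
  forall a b, f a = f b.
Proof.
move=> cM hF df a b.
have op (P : set F) : mopen mM (f @^-1` P).
  move=> x; rewrite image_chartI openE => u [xu Pu].
  have [V [oV Vu Vx fV]] :=
    zero_derivative_locally_constant hF (chart_range_open mM x) (df x) xu.
  apply: filterS (open_nbhs_nbhs (conj oV Vu)) => w Vw; split; first exact: Vx.
  by rewrite /= [f _](fV _ Vw).
have := cM (f @^-1` [set f b]) (op [set f b]) (op (~` [set f b]))
  (ex_intro _ b erefl).
by move=> /seteqP[_ /(_ a I)].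
Qed.

(** * Lie groups and the adjoint representation *)

Section LieGroup.
Variables (R : realType) (E : tvsType R) (G : groupType) (mG : manifold E G).
Hypothesis hG : lie_group mG.

Let hE : hausdorff_space E := model_hausdorff mG.

(** Near u, factor the product through the product of the charts at phi u and
    psi u. *)
Lemma plot_mul (X : tvsType R) (U : set X) (phi psi : X -> G) :
  hausdorff_space X -> plot mG U phi -> plot mG U psi ->
  plot mG U (fun u => phi u * psi u)%g.
Proof.
move=> hX pphi ppsi z; apply: smooth_on_local => u [Uu zu].
set a := phi u; set b := psi u.
have o1 : open (U `&` phi @^-1` dom mG a) by case: (pphi a).
have o2 : open (U `&` psi @^-1` dom mG b) by case: (ppsi b).
pose V := (U `&` phi @^-1` dom mG a) `&` (U `&` psi @^-1` dom mG b).
have oV : open V by exact: openI.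
have SP : smooth_on V (fun w => (chart mG a (phi w), chart mG b (psi w))).
  apply: smooth_on_pair => //.
    by apply: (smooth_on_subset oV _ (pphi a)) => w [].
  by apply: (smooth_on_subset oV _ (ppsi b)) => w [].
have SC := smooth_on_comp hX (prod_hausdorff hE hE) hE SP (hG.1 a b z).
eexists; eexists; split; last 2 first.
- exact: SC.
- by move=> w [[[_ /= da] [_ db]] _]; rewrite /= !chartK.
- move=> w [[[Uw /= da] [_ db]] [[p1 p2] [/= d1 d2 dz] [e1 e2]]]; split=> //=.
  by rewrite -(chartK da) -(chartK db) -e1 -e2 !chartK.
- split; first by split; split => //; exact: mem_dom.
  by exists (a, b) => //; split=> //=; exact: mem_dom.
Qed.

Lemma plot_inv (X : tvsType R) (U : set X) (phi : X -> G) :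
  hausdorff_space X -> plot mG U phi -> plot mG U (fun u => (phi u)^-1)%g.
Proof. by move=> hX pphi; apply: (plot_push hX hG.2 pphi). Qed.

Lemma smooth_mull (g : G) : smooth_map mG mG (fun h => g * h)%g.
Proof.
apply/smooth_mapE => x; apply: plot_mul => //; last exact: plot_chart_inv.
exact/plot_cst/chart_range_open.
Qed.

Lemma smooth_mulr (g : G) : smooth_map mG mG (fun h => h * g)%g.
Proof.
apply/smooth_mapE => x; apply: plot_mul => //; first exact: plot_chart_inv.
exact/plot_cst/chart_range_open.
Qed.

Lemma smooth_conjugation (g : G) : smooth_map mG mG (fun h => g * h * g^-1)%g.
Proof.
apply/smooth_mapE => x; have o := chart_range_open mG x.
apply: plot_mul => //; last exact: plot_cst.
by apply: plot_mul => //; [exact: plot_cst | exact: plot_chart_inv].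
Qed.

Let c1 := chart mG 1%g 1%g.
Let range1 := chart mG 1%g @` dom mG 1%g.

Lemma Ad_velocity (X : tvsType R) (U : set X) (phi : X -> G) a v g :
  plot mG U phi -> U a -> phi a = 1%g ->
  Ad mG g (velocity mG phi a v) = velocity mG (fun p => g * phi p * g^-1)%g a v.
Proof.
move=> pphi Ua phi1.
by rewrite (velocity_push v (smooth_conjugation g) pphi Ua I) phi1.
Qed.

Lemma Ad_chart_inv g v :
  Ad mG g v = velocity mG (fun x => g * chart_inv mG 1%g x * g^-1)%g c1 v.
Proof.
rewrite -(Ad_velocity v g (plot_chart_inv mG 1%g) (mem_chart mG 1%g)).
  by rewrite velocity_chart_inv.
exact: chart_inv_chart.
Qed.

Lemma Ad1 v : Ad mG 1%g v = v.
Proof.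
rewrite Ad_chart_inv -[RHS](velocity_chart_inv mG 1%g).
by apply: eq_velocity => x; rewrite mul1g invg1 mulg1.
Qed.

Lemma AdM g h v : Ad mG (g * h)%g v = Ad mG g (Ad mG h v).
Proof.
have o := chart_range_open mG 1%g.
rewrite !(Ad_chart_inv _ v).
rewrite (@Ad_velocity _ range1 _ _ _ g).
- by apply: eq_velocity => x; rewrite invgM !mulgA.
- apply: plot_mul => //; last exact: plot_cst.
  by apply: plot_mul => //; [exact: plot_cst | exact: plot_chart_inv].
- exact: mem_chart.
- by rewrite chart_inv_chart mulg1 mulgV.
Qed.

Lemma Ad_linear g c u v : Ad mG g (c *: u + v) = c *: Ad mG g u + Ad mG g v.
Proof. exact: (tangent_map_linear (smooth_conjugation g)). Qed.

(** Ad is a partial derivative of the smooth map (g, h) |-> g h g^-1, taken at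
    points (g, 1) in the direction (0, v). *)
Lemma Ad_smooth v : smooth_on range1 (fun x => Ad mG (chart_inv mG 1%g x) v).
Proof.
have oR : open range1 := chart_range_open mG 1%g.
have hEE := prod_hausdorff hE hE.
pose Phi (p : E * E) := (chart_inv mG 1 p.1 * chart_inv mG 1 p.2
   * (chart_inv mG 1 p.1)^-1)%g.
pose U := [set p : E * E | range1 p.1 /\ range1 p.2].
have oU : open U.
  rewrite openE => -[x y] [/= Rx Ry].
  by exists (range1, range1) => //; split; exact: open_nbhs_nbhs.
have p1 : plot mG U (chart_inv mG 1%g \o fst).
  apply: plot_subset (plot_comp hE hEE (plot_chart_inv mG 1%g)
    (smooth_on_fst _ hE)) => //.
  by move=> p [].
have p2 : plot mG U (chart_inv mG 1%g \o snd).
  apply: plot_subset (plot_comp hE hEE (plot_chart_inv mG 1%g)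
    (smooth_on_snd _ hE)) => //.
  by move=> p [].
have pPhi : plot mG U Phi.
  by apply: plot_mul => //; [exact: plot_mul | exact: plot_inv].
have Phi1 x : Phi (x, c1) = 1%g by rewrite /Phi /= chart_inv_chart mulg1 mulgV.
have Rc1 : range1 c1 by exact: mem_chart.
pose L (x : E) := ((x, c1), ((0 : E), v)).
have SL : smooth_on setT L.
  apply: smooth_on_pair => //; last exact: (smooth_on_cst _ _ openT).
  apply: smooth_on_pair => //; first exact: smooth_on_id.
  exact: (smooth_on_cst _ _ openT).
have SD := smooth_on_derive (pPhi 1%g).
have := smooth_on_comp hE (prod_hausdorff hEE hEE) hE SL SD.
set D := _ `&` _ => SC.
have RD : range1 `<=` D.
  move=> x Rx; split=> //; split=> //=; split; first by split.
  by rewrite /= Phi1; exact: mem_dom.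
apply: eq_smooth_on (smooth_on_subset oR RD SC) => x Rx /=.
rewrite -[X in chart mG X](Phi1 x) -[LHS]/(velocity mG Phi (x, c1) (0, v)).
have dl : is_dir_derive (fun y : E => (x, y)) c1 v (0, v).
  apply: is_dir_derive_pair; first exact: is_dir_derive_cst.
  exact: is_dir_derive_linear.
rewrite Ad_chart_inv -[RHS]/(velocity mG (Phi \o pair x) c1 v).
rewrite [RHS](velocity_comp pPhi); [|by split | by exists (0, v); exact: dl].
by rewrite (dir_derive_unique hEE dl).
Qed.

(** ad is defined by straight lines in the chart at 1; the chain rule extends
    this to all smooth families through 1. *)
Lemma is_dir_derive_Ad (X : tvsType R) (U : set X) (phi : X -> G) a u v :
  plot mG U phi -> U a -> phi a = 1%g ->
  is_dir_derive (fun p => Ad mG (phi p) v) a u (ad mG (velocity mG phi a u) v).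
Proof.
move=> pphi Ua phi1; rewrite /velocity phi1.
have da : (U `&` phi @^-1` dom mG 1%g) a.
  by split=> //; rewrite /= phi1; exact: mem_dom.
apply: (@is_dir_derive_near _ _ _
   ((fun x => Ad mG (chart_inv mG 1%g x) v) \o (chart mG 1%g \o phi))).
  have [o _] := pphi 1%g.
  by apply: filterS (open_nbhs_nbhs (conj o da)) => p [_ /= dp]; rewrite chartK.
rewrite /ad -[X in chart mG 1%g X]phi1.
rewrite -[chart mG 1%g (phi a)]/((chart mG 1%g \o phi) a).
have [oR SA] := Ad_smooth v.
apply: (is_dir_derive_comp oR (SA 1%N)).
  by exists (phi a) => //; case: da.
exact: dir_deriveP (smooth_on_derivable u (pphi 1%g) da).
Qed.

Lemma adD w u v : ad mG w (u + v) = ad mG w u + ad mG w v.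
Proof.
have H x : is_dir_derive (fun p => Ad mG (chart_inv mG 1%g p) x) c1 w
    (ad mG w x).
  rewrite -[w in ad mG w](velocity_chart_inv mG 1%g).
  exact: (is_dir_derive_Ad (plot_chart_inv mG 1%g) (mem_chart mG 1%g)
    (chart_inv_chart mG 1%g)).
apply: (cvg_unique hE (H (u + v))).
apply: (cvg_trans _ (tvs_cvgD (H u) (H v))); apply: near_eq_cvg.
near=> h; rewrite -scalerDr; congr (_ *: _).
have AdD g : Ad mG g (u + v) = Ad mG g u + Ad mG g v.
  by rewrite -[u in LHS]scale1r Ad_linear scale1r.
by rewrite !AdD opprD addrACA.
Unshelve. all: by end_near. Qed.

End LieGroup.

(** * Energy and right-invariant forms *)

Section Energy.
Variables (R : realType) (E : tvsType R) (A : E -> dual E).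
Hypothesis hA : inertia_operator A.

Lemma pairing_linear a (u v : E) (l : dual E) :
  pairing (a *: u + v) l = a * pairing u l + pairing v l.
Proof. by rewrite /pairing linearP. Qed.

Lemma pairingDl (u v : E) (l : dual E) :
  pairing (u + v) l = pairing u l + pairing v l.
Proof. by rewrite -[u in LHS]scale1r pairing_linear mul1r. Qed.

Lemma pairingC u v : pairing v (A u) = pairing u (A v).
Proof. by case: hA. Qed.

Lemma quadratic_energy : quadratic_form (energy A).
Proof.
exists (fun u v => 2^-1 * pairing u (A v)); split=> //.
- by move=> a u v w; rewrite pairing_linear; ring.
- by move=> u v; rewrite pairingC.
Qed.

(** The kernel of A is the radical of the quadratic form, by symmetry of A. *)
Lemma energyD_ker u w : op_ker A w -> energy A (u + w) = energy A u.
Proof.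
move=> kw; rewrite /energy pairingDl (pairingC (u + w) u) (pairingC (u + w) w).
by rewrite pairingDl (pairingC u w) !kw !addr0.
Qed.

Lemma energy_ker w : op_ker A w -> energy A w = 0.
Proof. by move=> kw; rewrite /energy kw mulr0. Qed.

Lemma is_dir_derive_energy_comp (X : tvsType R) (f : X -> E) a v l :
  is_dir_derive f a v l ->
  is_dir_derive (energy A \o f : X -> R^o) a v (pairing l (A (f a)) : R^o).
Proof.
move=> fl; have [_ _ cE] := hA; have qE := quadratic_energy.
have -> : pairing l (A (f a)) = dir_derive (energy A : E -> R^o) (f a) l.
  apply: esym; apply: (@dir_derive_unique R E R^o).
    exact: regular_hausdorff.
  rewrite pairingC.
  have -> : pairing (f a) (A l) = 2 * (2^-1 * pairing (f a) (A l)) by field.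
  apply: (@quadratic_dir_derive R E _
    (fun u v => 2^-1 * pairing u (A v))) => //.
    by move=> b u w x; rewrite pairing_linear; ring.
  by move=> u w; rewrite pairingC.
apply: (is_dir_derive_comp openT) => //; exact: Ck_on_quadratic.
Qed.

End Energy.

Lemma quadratic_form_linear_comp (R : realType) (V W : lmodType R) (q : W -> R)
    (L : V -> W) : quadratic_form q ->
  (forall c u v, L (c *: u + v) = c *: L u + L v) -> quadratic_form (q \o L).
Proof.
move=> [b [bl bs qb]] lL; exists (fun u v => b (L u) (L v)); split.
- by move=> a u v w; rewrite lL bl.
- by move=> u v; rewrite bs.
- by move=> v; rewrite /= qb.
Qed.

Lemma right_invariant_form_velocity (R : realType) (E X : tvsType R)
    (G : groupType) (mG : manifold E G) (hG : lie_group mG) (q : E -> R)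
    (U : set X) (phi : X -> G) a v : plot mG U phi -> U a ->
  right_invariant_form mG q (phi a) (velocity mG phi a v) =
  q (velocity mG (fun p => phi p * (phi a)^-1)%g a v).
Proof.
move=> pphi Ua; rewrite /right_invariant_form.
by rewrite -(velocity_push v (smooth_mulr hG (phi a)^-1%g) pphi Ua I).
Qed.

(** * Descent to the space of right cosets *)

Section Descent.
Variables (R : realType) (E : tvsType R) (G : groupType) (mG : manifold E G).
Hypothesis hG : lie_group mG.
Variable A : E -> dual E.
Hypothesis hA : inertia_operator A.
Variables (F : tvsType R) (H : groupType) (mH : manifold F H) (iota : H -> G).
Variable K : set G.
Hypothesis hK : lie_subgroup_of_subalgebra mG mH iota (op_ker A) K.

Let hH : lie_group mH := sub_lie_group hK.
Let hE : hausdorff_space E := model_hausdorff mG.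
Let hF : hausdorff_space F := model_hausdorff mH.

Lemma sub_morph1 : iota 1%g = 1%g.
Proof. by apply: (@mulgI _ (iota 1)%g); rewrite -(sub_morph hK) !mulg1. Qed.

Lemma coset_proj_mull h g : coset_proj K (iota h * g)%g = coset_proj K g.
Proof.
apply: eq_exist; rewrite /right_coset -(sub_range hK).
apply/seteqP; split=> _ [_ [k _ <-] <-].
  by exists (iota (k * h)%g); [exists (k * h)%g | rewrite (sub_morph hK) mulgA].
exists (iota (k * h^-1)%g); first by exists (k * h^-1)%g.
by rewrite mulgA -(sub_morph hK) mulgVK.
Qed.

Lemma coset_proj_eq g g' :
  coset_proj K g = coset_proj K g' -> exists h, g' = (iota h * g)%g.
Proof.
move=> /(f_equal (@proj1_sig _ _)) /= e.
have : right_coset K g' g'.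
  exists 1%g; last by rewrite mul1g.
  by rewrite -(sub_range hK); exists 1%g => //; exact: sub_morph1.
by rewrite -e -(sub_range hK) => -[_ [h _ <-] <-]; exists h.
Qed.

Lemma coset_proj_surj (q : coset_space K) : exists g, coset_proj K g = q.
Proof.
by case: q => C [g e]; exists g; apply: eq_exist; rewrite -e.
Qed.

(** Curves in K are taken as images of plots of H, since K carries no topology
    of its own; velocities at 1 then lie in the kernel of A. *)
Lemma energy_Ad_derive (X : tvsType R) (U : set X) (phi : X -> H) a u v :
  hausdorff_space X -> plot mH U phi -> U a -> phi a = 1%g ->
  let w := tangent_map mH mG iota 1%g (velocity mH phi a u) in
  op_ker A w /\
  is_dir_derive (fun p => energy A (Ad mG (iota (phi p)) v) : R^o) a u
    (pairing v (A (ad mG w v)) : R^o).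
Proof.
move=> hX pphi Ua phi1 w; split.
  by have [+ _ _] := sub_tangent hK; apply.
have pio : plot mG U (iota \o phi).
  by apply: (plot_push hX (sub_smooth hK) pphi).
have io1 : (iota \o phi) a = 1%g by rewrite /= phi1 sub_morph1.
have ve : velocity mG (iota \o phi) a u = w.
  by rewrite (velocity_push u (sub_smooth hK) pphi Ua I) phi1.
have dAd : is_dir_derive (fun p => Ad mG (iota (phi p)) v) a u (ad mG w v).
  by rewrite -ve; exact: (is_dir_derive_Ad hG pio Ua io1).
have := is_dir_derive_energy_comp hA dAd.
by rewrite phi1 sub_morph1 (Ad1 hG) pairingC.
Qed.

Definition Ad_invariant := forall h v, energy A (Ad mG (iota h) v) = energy A v.

(** The left-hand side is the case u = v of the right-hand side, which is
    symmetric in u and v: polarization. *)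
Lemma ad_skew_diag :
  (forall w v, op_ker A w -> pairing v (A (ad mG w v)) = 0) <->
  (forall w u v, op_ker A w ->
     pairing (ad mG w v) (A u) = - pairing v (A (ad mG w u))).
Proof.
split=> [diag w u v kw | skew w v kw]; last first.
  have := skew w v v kw; rewrite (pairingC hA) => e.
  by lra.
have := diag w (u + v) kw; rewrite (adD hG).
move: (diag w u kw) (diag w v kw); move: (ad mG w u) (ad mG w v) => a b.
rewrite (pairingC hA a u) (pairingC hA b v) => au bv.
rewrite pairingDl (pairingC hA (a + b) u) (pairingC hA (a + b) v) !pairingDl.
rewrite (pairingC hA v a); lra.
Qed.

(** Differentiate the constant family E (Ad_(iota h) v) at h = 1 along
    straight lines in the chart of H. *)
Lemma Ad_invariant_ad :
  Ad_invariant -> forall w v, op_ker A w -> pairing v (A (ad mG w v)) = 0.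
Proof.
move=> inv w v; have [_ _ surj] := sub_tangent hK; move=> /surj[w0 _ <-].
have [_] := energy_Ad_derive w0 v hF (plot_chart_inv mH 1%g) (mem_chart mH 1%g)
  (chart_inv_chart mH 1%g).
rewrite velocity_chart_inv => d.
have d0 : is_dir_derive
    (fun p => energy A (Ad mG (iota (chart_inv mH 1%g p)) v) : R^o)
    (chart mH 1%g 1%g) w0 0.
  have -> : (fun p => energy A (Ad mG (iota (chart_inv mH 1%g p)) v) : R^o) =
    (fun=> energy A v) by apply/funext => p; rewrite inv.
  exact: is_dir_derive_cst.
exact: (cvg_unique (@regular_hausdorff R) d d0).
Qed.

(** At a point h0 of H, write h = (h * h0^-1) * h0: the derivative at h0 is a
    derivative at 1 with Ad_(iota h0) v in place of v. *)
Lemma ad_Ad_invariant :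
  (forall w v, op_ker A w -> pairing v (A (ad mG w v)) = 0) -> Ad_invariant.
Proof.
move=> diag h v; rewrite -[RHS](congr1 (energy A) (Ad1 hG v)) -sub_morph1.
apply: (@connected_constant R F R^o H mH (fun h => energy A (Ad mG (iota h) v))
  (sub_connected hK) (@regular_hausdorff R)) => x u0 v0 xu.
set h0 := chart_inv mH x u0.
pose phi p := (chart_inv mH x p * h0^-1)%g.
have pphi : plot mH (chart mH x @` dom mH x) phi.
  apply: plot_mul => //; first exact: plot_chart_inv.
  exact/plot_cst/chart_range_open.
have phi1 : phi u0 = 1%g by rewrite /phi mulgV.
have [kw] := energy_Ad_derive v0 (Ad mG (iota h0) v) hF pphi xu phi1.
rewrite (diag _ _ kw); apply: is_dir_derive_near; apply: filterE => p /=.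
by rewrite -(AdM hG) -(sub_morph hK) /phi mulgVK.
Qed.

Variables (E' : tvsType R) (mQ : manifold E' (coset_space K)).
Hypothesis hQ : quotient_manifold mG mH iota mQ.

Let EG := right_invariant_form mG (energy A).
Let proj := @coset_proj G K.
Let hE' : hausdorff_space E' := model_hausdorff mQ.

Lemma tangent_proj_mull h g X :
  tangent_map mG mQ proj (iota h * g)%g
    (tangent_map mG mG (fun p => iota h * p)%g g X) =
  tangent_map mG mQ proj g X.
Proof.
rewrite (tangent_map_comp X (smooth_mull hG (iota h)) (proj_smooth hQ) I).
by apply: eq_tangent_map => p; exact: coset_proj_mull.
Qed.

(** Through right translations, the left translation by iota h becomes
    Ad_(iota h). *)
Lemma right_invariant_form_mull h g X : Ad_invariant ->
  EG (iota h * g)%g (tangent_map mG mG (fun p => iota h * p)%g g X) = EG g X.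
Proof.
move=> inv; have cg := smooth_conjugation hG (iota h).
have rg := smooth_mulr hG g^-1%g.
rewrite /EG /right_invariant_form -[RHS](inv h) /Ad -(mulgV g).
rewrite (tangent_map_comp X rg cg I).
rewrite (tangent_map_comp X (smooth_mull hG _) (smooth_mulr hG _) I).
apply: (congr1 (energy A)); apply: eq_tangent_map => p /=.
by rewrite invgM !mulgA.
Qed.

(** The left translate of v by g is the right translate of Ad_g v. *)
Lemma right_invariant_form1 g v :
  EG (g * 1)%g (tangent_map mG mG (fun p => g * p)%g 1%g v) =
  energy A (Ad mG g v).
Proof.
rewrite /EG /right_invariant_form.
rewrite (tangent_map_comp v (smooth_mull hG _) (smooth_mulr hG _) I) mulg1.
by [].
Qed.

(** Vectors with the same image in the quotient differ, after a left
    translation by K, by a vertical vector, that is, by the right translate of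
    a vector of the kernel of A. *)
Lemma right_invariant_form_fiber g g' X X' : Ad_invariant ->
  proj g = proj g' ->
  tangent_map mG mQ proj g X = tangent_map mG mQ proj g' X' ->
  EG g X = EG g' X'.
Proof.
move=> inv /coset_proj_eq[h ->] {g'}; set g' := (iota h * g)%g.
rewrite -(tangent_proj_mull h) -(right_invariant_form_mull h g X inv).
set Y := tangent_map mG mG _ g X => e.
have lin := tangent_map_linear (proj_smooth hQ) I.
have : tangent_map mG mQ proj g' (- 1 *: X' + Y) = 0.
  by rewrite lin e scaleN1r addNr.
have pv := proj_vertical hQ g'.
move=> e0; have : range (tangent_map mH mG (fun h : H => iota h * g')%g 1%g)
    (- 1 *: X' + Y) by rewrite -pv.
move=> [w0 _ ew].
have -> : Y = 1 *: X' + (- 1 *: X' + Y).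
  by rewrite scale1r scaleN1r addrA subrr add0r.
rewrite -ew /EG /right_invariant_form.
have hR := smooth_mulr hG g'^-1%g; rewrite (tangent_map_linear hR I) scale1r.
apply: energyD_ker => //.
have [+ _ _] := sub_tangent hK => /(_ w0 I).
suff -> : tangent_map mH mG iota 1%g w0 = tangent_map mG mG
  (fun p => p * g'^-1)%g g'
  (tangent_map mH mG (fun h => iota h * g')%g 1%g w0) by [].
have smh : smooth_map mH mG (fun h => iota h * g')%g.
  apply/smooth_mapE => x; apply: plot_mul => //.
    by apply: (plot_push hF (sub_smooth hK) (plot_chart_inv mH x)).
  exact/plot_cst/chart_range_open.
have := tangent_map_comp (x := 1%g) w0 smh hR I.
rewrite sub_morph1 mul1g => ->.
by apply: eq_tangent_map => p; rewrite /= mulgK.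
Qed.

Lemma tangent_proj_section (W : set (coset_space K)) (s : coset_space K -> G)
    q v :
  smooth_map_on mQ mG W s -> (forall q', W q' -> proj (s q') = q') -> W q ->
  tangent_map mG mQ proj (s q) (tangent_map mQ mG s q v) = v.
Proof.
move=> sS sK Wq; rewrite (tangent_map_comp v sS (proj_smooth hQ) Wq).
rewrite tangent_mapE -[RHS](velocity_chart_inv mQ q).
apply: near_eq_velocity.
have /smooth_map_onE/(_ q)/plot_open := sS; rewrite image_chartI => o.
have cq : (chart mQ q @` dom mQ q `&` chart_inv mQ q @^-1` W) (chart mQ q q).
  by split; [exact: mem_chart | rewrite /= chart_inv_chart].
by apply: filterS (open_nbhs_nbhs (conj o cq)) => y [_ /sK].
Qed.

(** The right translate to 1 of the velocity of phi at x is the derivative of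
    (z, z') |-> phi z * (phi z')^-1 at (x, x) in the direction (v, 0), hence
    depends smoothly on x and v. *)
Lemma smooth_right_invariant_form (X : tvsType R) (U : set X) (phi : X -> G) :
  hausdorff_space X -> plot mG U phi ->
  smooth_on (U `*` setT)
    (fun p : X * X => EG (phi p.1) (velocity mG phi p.1 p.2) : R^o).
Proof.
move=> hX pphi; have oU := plot_open pphi.
have hXX := prod_hausdorff hX hX.
pose Psi (p : X * X) := (phi p.1 * (phi p.2)^-1)%g.
have oUU : open (U `*` U).
  rewrite openE => -[x y] [/= Rx Ry].
  by exists (U, U) => //; split; exact: open_nbhs_nbhs.
have p1 : plot mG (U `*` U) (phi \o fst).
  apply: plot_subset (plot_comp hX hXX pphi (smooth_on_fst _ hX)) => //.
  by move=> p [].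
have p2 : plot mG (U `*` U) (phi \o snd).
  apply: plot_subset (plot_comp hX hXX pphi (smooth_on_snd _ hX)) => //.
  by move=> p [].
have pPsi : plot mG (U `*` U) Psi by apply: plot_mul => //; exact: plot_inv.
have Psi1 x : Psi (x, x) = 1%g by rewrite /Psi /= mulgV.
pose L (p : X * X) := ((p.1, p.1), (p.2, (0 : X))).
have SL : smooth_on setT L.
  have S1 := @smooth_on_fst R X X hX; have S2 := @smooth_on_snd R X X hX.
  apply: smooth_on_pair => //; first exact: smooth_on_pair.
  by apply: smooth_on_pair => //; exact: (smooth_on_cst _ _ openT).
have SD := smooth_on_derive (pPsi 1%g).
have := smooth_on_comp hXX (prod_hausdorff hXX hXX) hE SL SD.
set D := _ `&` _ => SC.
have UD : U `*` setT `<=` D.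
  move=> [x v] [/= Ux _]; split=> //; split=> //=; split; first by split.
  by rewrite /= Psi1; exact: mem_dom.
have SE : smooth_on setT (energy A : E -> R^o).
  have [_ _ cE] := hA; split; first exact: openT.
  by move=> k; apply: Ck_on_quadratic => //; exact: quadratic_energy.
have oUT : open (U `*` [set: X]) by exact: setXT_open.
have := smooth_on_comp hXX hE (@regular_hausdorff R)
  (smooth_on_subset oUT UD SC) SE.
rewrite preimage_setT setIT; apply: eq_smooth_on => -[x v] [/= Ux _].
rewrite /EG (right_invariant_form_velocity hG (energy A) v pphi Ux) /=.
have dl : is_dir_derive (fun y : X => (y, x)) x v (v, 0).
  apply: is_dir_derive_pair; last exact: is_dir_derive_cst.
  exact: is_dir_derive_linear.
rewrite -[X in velocity mG X]/(Psi \o (fun y => (y, x))).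
rewrite [in RHS](velocity_comp pPsi); [|by split | by exists (v, 0); exact: dl].
by rewrite (dir_derive_unique hXX dl) /velocity Psi1.
Qed.

(** Each point q of the quotient gets its own local section, which defines the
    form at q; the value does not depend on the section, so near any point a
    single section computes the form at all points and proves it smooth. *)
Lemma Ad_invariant_descends : Ad_invariant -> descends mG mQ EG.
Proof.
move=> inv.
have /choice[S HS] : forall q : coset_space K,
    exists Ws : set (coset_space K) * (coset_space K -> G),
    [/\ Ws.1 q, smooth_map_on mQ mG Ws.1 Ws.2 &
        forall q', Ws.1 q' -> proj (Ws.2 q') = q'].
  move=> q; have [g <-] := coset_proj_surj q.
  by have [W [s [Wg _ sS sK]]] := proj_section hQ g; exists (W, s).
pose Q q v := EG ((S q).2 q) (tangent_map mQ mG (S q).2 q v).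
have QE W s q v : smooth_map_on mQ mG W s ->
    (forall q', W q' -> proj (s q') = q') -> W q ->
    Q q v = EG (s q) (tangent_map mQ mG s q v).
  move=> sS sK Wq; have [Sq SS SK] := HS q.
  apply: right_invariant_form_fiber => //.
    by rewrite SK // sK.
  by rewrite (tangent_proj_section v SS SK Sq)
    (tangent_proj_section v sS sK Wq).
exists Q; last first.
  move=> g X; have [Sq SS SK] := HS (proj g).
  apply: right_invariant_form_fiber => //; first by rewrite SK.
  by rewrite (tangent_proj_section _ SS SK Sq).
split=> [q|x].
  have [Sq SS SK] := HS q.
  apply: (quadratic_form_linear_comp (L := fun v =>
    tangent_map mG mG (fun p => p * ((S q).2 q)^-1)%g ((S q).2 q)
      (tangent_map mQ mG (S q).2 q v)) (quadratic_energy hA)) => c u v.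
  rewrite (tangent_map_linear SS Sq).
  by rewrite (tangent_map_linear (smooth_mulr hG _) I).
apply: smooth_on_local => -[u0 v0] [/= xu0 _].
have [Sq SS SK] := HS (chart_inv mQ x u0).
set W := (S _).1 in Sq SS SK; set s := (S _).2 in SS SK.
have /smooth_map_onE/(_ x) := SS; rewrite image_chartI => psi.
set U := _ `&` _ in psi.
exists (U `*` setT); eexists; split.
- by move=> [u v] [[/= xu _] _].
- by [].
- exact: (smooth_right_invariant_form hE' psi).
move=> [u v] [[/= xu Wu] _].
have pU := plot_subset (plot_open psi) (@subIsetl _ _ _) (plot_chart_inv mQ x).
have := velocity_push v SS pU (conj xu Wu) Wu.
rewrite (QE W s (chart_inv mQ x u) _ SS SK Wu) => E1.
exact: (congr1 (EG (s (chart_inv mQ x u))) E1).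
Qed.

Lemma descends_Ad_invariant : descends mG mQ EG -> Ad_invariant.
Proof.
move=> [Q _ EQ] h v.
have E1 k : energy A (Ad mG (iota k) v) =
    Q (proj 1%g) (tangent_map mG mQ proj 1%g v).
  by rewrite -right_invariant_form1 EQ tangent_proj_mull coset_proj_mull.
by rewrite -[v in RHS](Ad1 hG) -sub_morph1 !E1.
Qed.

End Descent.

Theorem theorem4p1 (R : realType)
    (E : tvsType R) (G : groupType) (mG : manifold E G) (hG : lie_group mG)
    (A : E -> dual E) (hA : inertia_operator A) (hdeg : degenerate A)
    (hk : lie_subalgebra mG (op_ker A))
    (F : tvsType R) (H : groupType) (mH : manifold F H) (iota : H -> G)
    (K : set G) (hK : lie_subgroup_of_subalgebra mG mH iota (op_ker A) K)
    (E' : tvsType R) (mQ : manifold E' (coset_space K))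
    (hQ : quotient_manifold mG mH iota mQ) :
  descends mG mQ (right_invariant_form mG (energy A)) <->
  (forall w, op_ker A w -> energy A w = 0) /\
  (forall w u v, op_ker A w ->
     pairing (ad mG w v) (A u) = - pairing v (A (ad mG w u))).
Proof.
rewrite -(ad_skew_diag hG hA); split=> [desc | [_ diag]].
  split=> [w|]; first exact: energy_ker.
  exact: (Ad_invariant_ad hG hA hK (descends_Ad_invariant hG hK hQ desc)).
exact: (Ad_invariant_descends hG hA hK hQ (ad_Ad_invariant hG hA hK diag)).
Qed.
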